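(* For an integer $q\ge 3$, let $L'(q)$ be the minimum, over all infinite 2D words $w$ with $|Alph(w)|=q$ that have at least one non-trivial HV-palindromic factor, of the number of distinct non-empty HV-palindromic factors of $w$. Then $L'(3)=5$ and $L'(q)=q+1$ for every $q>3$.
   Context: An infinite 2D word over a finite alphabet $\Sigma$ is an array $w=[w_{i,j}]_{i,j\ge 1}$ with entries in $\Sigma$. $Alph(w)$ is the set of letters occurring in $w$. A factor of $w$ is a finite sub-array of consecutive rows and columns, considered as a finite 2D word; factors are counted as distinct arrays, independently of their positions. A 1D word is a palindrome if it equals its reversal, and a finite 2D word is an HV-palindrome if each of its rows and each of its columns is a 1D palindrome. An HV-palindromic factor is trivial if it has size $(1,1)$ (a single letter) and non-trivial otherwise. *)

(* Defs.v *)
From mathcomp Require Import all_boot matrix.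
From mathcomp Require Import boolp classical_sets functions cardinality.

Set Implicit Arguments.
Unset Strict Implicit.
Unset Printing Implicit Defensive.

Local Open Scope classical_set_scope.
Local Open Scope card_scope.

(* Rows and columns are indexed from 0 instead of 1. *)
Definition inf_word2 (S : Type) := nat -> nat -> S.

Definition Alph (S : Type) (w : inf_word2 S) : set S :=
  [set a | exists i j, w i j = a].

(* Words of different sizes are distinct elements of this single type, so that
   factors of all sizes can be collected, and counted, in one set. *)
Definition fin_word2 (S : Type) := {p : nat * nat & 'M[S]_(p.1, p.2)}.

Definition size2 (S : Type) (u : fin_word2 S) : nat * nat := tag u.

Definition nonempty2 (S : Type) (u : fin_word2 S) : Prop :=
  (0 < (size2 u).1)%N /\ (0 < (size2 u).2)%N.

Definition factor_at (S : Type) (w : inf_word2 S) (i j m n : nat) :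
    fin_word2 S :=
  existT (fun p : nat * nat => 'M[S]_(p.1, p.2)) (m, n)
    (\matrix_(k < m, l < n) w (i + k)%N (j + l)%N)%R.

Definition is_factor (S : Type) (w : inf_word2 S) (u : fin_word2 S) : Prop :=
  exists i j m n, u = factor_at w i j m n.

Definition palindrome (S : Type) (s : seq S) : Prop := rev s = s.

Definition row_word (S : Type) (m n : nat) (M : 'M[S]_(m, n)) (k : 'I_m) :
  seq S := [seq M k l | l <- enum 'I_n].

Definition col_word (S : Type) (m n : nat) (M : 'M[S]_(m, n)) (l : 'I_n) :
  seq S := [seq M k l | k <- enum 'I_m].

Definition HV_palindrome (S : Type) (u : fin_word2 S) : Prop :=
  (forall k, palindrome (row_word (tagged u) k)) /\
  (forall l, palindrome (col_word (tagged u) l)).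

Definition HV_pal_factors (S : Type) (w : inf_word2 S) : set (fin_word2 S) :=
  [set u | [/\ is_factor w u, nonempty2 u & HV_palindrome u]].

Definition has_nontrivial_HV_pal (S : Type) (w : inf_word2 S) : Prop :=
  exists2 u, HV_pal_factors w u & size2 u <> (1, 1).

Definition admissible (q : nat) (S : finType) (w : inf_word2 S) : Prop :=
  Alph w #= `I_q /\ has_nontrivial_HV_pal w.

(* L'(q) = m.  The lower bound compares cardinals, so it also covers the words
   with infinitely many HV-palindromic factors. *)
Definition is_L' (q m : nat) : Prop :=
  (exists (S : finType) (w : inf_word2 S),
     admissible q w /\ HV_pal_factors w #= `I_m) /\
  (forall (S : finType) (w : inf_word2 S),
     admissible q w -> `I_m #<= HV_pal_factors w).

(* Main.v *)
(** A palindrome of length at least 2 has [aa] or [aba] at its center, so the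
    existence of a non-trivial HV-palindromic factor amounts to an occurrence of
    [aa] or [aba] in some row or column, and the q letters together with such a
    factor give at least q + 1.  If q = 3 and, say, a horizontal [aa] or [aba]
    is the only non-trivial HV-palindrome, then any three consecutive letters of
    a column are distinct, so columns are 3-periodic; following the two columns
    through the letters a of the palindrome downwards forces two equal letters
    in consecutive positions of a neighbouring column, a contradiction.
    Conversely, the word with entries i + 2 j mod 3 has no non-trivial
    HV-palindrome; changing its corner to 2 creates the row factor 22 and, in
    the first column, 212.  For q > 3 the latter is destroyed by writing the
    extra letters 3, ..., q - 1 in the first column from the third row on. *)
Require Import Defs.
From mathcomp Require Import all_boot matrix zify.
From mathcomp Require Import boolp classical_sets functions cardinality.

Set Implicit Arguments.
Unset Strict Implicit.
Unset Printing Implicit Defensive.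

Local Open Scope classical_set_scope.
Local Open Scope card_scope.

(** * Palindromes and their centers *)

Lemma palindrome_map_iota (S : Type) (g : nat -> S) (n : nat) :
  palindrome [seq g l | l <- iota 0 n] <->
  forall l, l < n -> g l = g (n.-1 - l).
Proof.
rewrite /palindrome; split=> [E l ln|E].
  move/(congr1 (fun s => nth (g 0) s l)): E.
  rewrite nth_rev size_map size_iota //.
  rewrite !(nth_map 0) ?size_iota ?nth_iota //; try lia.
  by rewrite !add0n => <-; congr g; lia.
apply: (@eq_from_nth _ (g 0)); rewrite size_rev // size_map size_iota => l ln.
rewrite nth_rev size_map size_iota //.
rewrite !(nth_map 0) ?size_iota ?nth_iota //; try lia.
by rewrite !add0n [RHS]E //; congr g; lia.
Qed.

(** The position [c] starts the central pair or triple. The length is recorded as well, so that a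
    center whose position is known determines the extent of the whole palindrome. *)
Lemma palindrome_center (S : Type) (g : nat -> S) (n : nat) :
  1 < n -> (forall l, l < n -> g l = g (n.-1 - l)) ->
  exists c, (n = c.*2.+2 /\ g c = g c.+1) \/ (n = c.*2.+3 /\ g c = g c.+2).
Proof.
move=> n1 E; exists (n./2.-1); have := E (n./2.-1).
case: (boolP (odd n)) => on.
  rewrite (_ : n.-1 - n./2.-1 = n./2.-1.+2); last lia.
  by move=> En; right; split; [lia | apply: En; lia].
rewrite (_ : n.-1 - n./2.-1 = n./2.-1.+1); last lia.
by move=> En; left; split; [lia | apply: En; lia].
Qed.

(** * HV-palindromic factors of an infinite word *)

Section Factors.
Variable S : Type.
Implicit Types (w : inf_word2 S) (u : fin_word2 S).

(** Reading entries at natural indices, with [None] out of range, gives all sizes a common result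
    type; an equality of dependent pairs then yields equalities of entries without any transport. *)
Definition entry2 u (k l : nat) : option S :=
  if insub k is Some a then
    if insub l is Some b then Some (tagged u a b) else None
  else None.

Lemma entry2_factor_at w i j m n k l : k < m -> l < n ->
  entry2 (factor_at w i j m n) k l = Some (w (i + k) (j + l)).
Proof.
move=> km ln; rewrite /entry2 /=.
by rewrite !insubT /= mxE.
Qed.

Lemma factor_at_inj w i j m n i' j' m' n' :
  factor_at w i j m n = factor_at w i' j' m' n' ->
  [/\ m = m', n = n' & forall k l, k < m -> l < n ->
      w (i + k) (j + l) = w (i' + k) (j' + l)].
Proof.
move=> E; have [Em En] : (m, n) = (m', n') := congr1 (@size2 S) E.
subst m' n'; split=> // k l km ln.
move/(congr1 (fun u => entry2 u k l)): E.
by rewrite !entry2_factor_at // => -[].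
Qed.

Lemma HV_palindrome_factor_at w i j m n :
  HV_palindrome (factor_at w i j m n) <->
  (forall k l, k < m -> l < n ->
    w (i + k) (j + l) = w (i + k) (j + (n.-1 - l)) /\
    w (i + k) (j + l) = w (i + (m.-1 - k)) (j + l)).
Proof.
have rowE (k : 'I_m) :
    palindrome (row_word (tagged (factor_at w i j m n)) k) <->
    forall l, l < n -> w (i + k) (j + l) = w (i + k) (j + (n.-1 - l)).
  rewrite -(palindrome_map_iota (fun l => w (i + k) (j + l))).
  by rewrite -val_enum_ord -map_comp /row_word /=;
    under eq_map => l do rewrite mxE.
have colE (l : 'I_n) :
    palindrome (col_word (tagged (factor_at w i j m n)) l) <->
    forall k, k < m -> w (i + k) (j + l) = w (i + (m.-1 - k)) (j + l).
  rewrite -(palindrome_map_iota (fun k => w (i + k) (j + l))).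
  by rewrite -val_enum_ord -map_comp /col_word /=;
    under eq_map => k do rewrite mxE.
split=> [[Hr Hc] k l km ln|H]; first split.
- by have /rowE := Hr (Ordinal km); apply.
- by have /colE := Hc (Ordinal ln); apply.
by split=> [k|l]; [apply/rowE => l ln | apply/colE => k km];
  have [] := H k l (ltac:(done)) (ltac:(done)).
Qed.

Lemma HV_pal_factors_at w i j m n :
  HV_pal_factors w (factor_at w i j m n) <->
  [/\ 0 < m, 0 < n & forall k l, k < m -> l < n ->
    w (i + k) (j + l) = w (i + k) (j + (n.-1 - l)) /\
    w (i + k) (j + l) = w (i + (m.-1 - k)) (j + l)].
Proof.
split=> [[_ [m0 n0] /HV_palindrome_factor_at H]|[m0 n0 H]]; first by split.
by split; [exists i, j, m, n | | apply/HV_palindrome_factor_at].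
Qed.

Lemma HV_pal_row2 w i j :
  HV_pal_factors w (factor_at w i j 1 2) <-> w i j = w i j.+1.
Proof.
apply: (iff_trans (HV_pal_factors_at _ _ _ _ _)).
split=> [[_ _ /(_ 0 0 isT isT)[+ _]]|E].
  by rewrite /= !addn0 addn1.
by split=> // -[|//] [|[|//]] _ _; rewrite /= ?subn0 ?subnn !(addn0, addn1).
Qed.

Lemma HV_pal_row3 w i j :
  HV_pal_factors w (factor_at w i j 1 3) <-> w i j = w i j.+2.
Proof.
apply: (iff_trans (HV_pal_factors_at _ _ _ _ _)).
split=> [[_ _ /(_ 0 0 isT isT)[+ _]]|E].
  by rewrite /= !addn0 addn2.
by split=> // -[|//] [|[|[|//]]] _ _;
  rewrite /= ?subn0 ?subnn ?(subSS, subn0) !(addn0, addn1, addn2).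
Qed.

Lemma HV_pal_col2 w i j :
  HV_pal_factors w (factor_at w i j 2 1) <-> w i j = w i.+1 j.
Proof.
apply: (iff_trans (HV_pal_factors_at _ _ _ _ _)).
split=> [[_ _ /(_ 0 0 isT isT)[_ +]]|E].
  by rewrite /= !addn0 addn1.
by split=> // -[|[|//]] [|//] _ _; rewrite /= ?subn0 ?subnn !(addn0, addn1).
Qed.

Lemma HV_pal_col3 w i j :
  HV_pal_factors w (factor_at w i j 3 1) <-> w i j = w i.+2 j.
Proof.
apply: (iff_trans (HV_pal_factors_at _ _ _ _ _)).
split=> [[_ _ /(_ 0 0 isT isT)[_ +]]|E].
  by rewrite /= !addn0 addn2.
by split=> // -[|[|[|//]]] [|//] _ _;
  rewrite /= ?subn0 ?subnn ?(subSS, subn0) !(addn0, addn1, addn2).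
Qed.

Lemma HV_pal_row_center w i j m n k :
  HV_pal_factors w (factor_at w i j m n) -> 1 < n -> k < m ->
  exists c,
    (n = c.*2.+2 /\ w (i + k) (j + c) = w (i + k) (j + c).+1) \/
    (n = c.*2.+3 /\ w (i + k) (j + c) = w (i + k) (j + c).+2).
Proof.
move=> /HV_pal_factors_at[_ _ H] n1 km.
have [|c] := @palindrome_center S (fun l => w (i + k) (j + l)) n n1.
  by move=> l ln; have [] := H k l km ln.
by exists c; rewrite -!addnS.
Qed.

Lemma HV_pal_col_center w i j m n l :
  HV_pal_factors w (factor_at w i j m n) -> 1 < m -> l < n ->
  exists c,
    (m = c.*2.+2 /\ w (i + c) (j + l) = w (i + c).+1 (j + l)) \/
    (m = c.*2.+3 /\ w (i + c) (j + l) = w (i + c).+2 (j + l)).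
Proof.
move=> /HV_pal_factors_at[_ _ H] m1 ln.
have [|c] := @palindrome_center S (fun k => w (i + k) (j + l)) m m1.
  by move=> k km; have [] := H k l km ln.
by exists c; rewrite -!addnS.
Qed.

(** The definition is symmetric in rows and columns; this reduces vertical palindromes to horizontal
    ones. *)
Lemma HV_pal_tr w i j m n :
  HV_pal_factors (fun k l => w l k) (factor_at (fun k l => w l k) i j m n) <->
  HV_pal_factors w (factor_at w j i n m).
Proof.
by split=> /HV_pal_factors_at[m0 n0 H]; apply/HV_pal_factors_at; split=> // k l
  km ln; have [] := H l k ln km.
Qed.

(** The center of the top row is itself an HV-palindrome, since the columns of a one-row factor have
    length 1. *)
Lemma HV_pal_row_short w i j m n :
  HV_pal_factors w (factor_at w i j m n) -> 1 < n ->
  exists j' n', (n' = 2 \/ n' = 3) /\ HV_pal_factors w (factor_at w i j' 1 n').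
Proof.
move=> uP n1; have /HV_pal_factors_at[m0 _ _] := uP.
have [c] := HV_pal_row_center uP n1 m0; rewrite addn0 => -[[_ E]|[_ E]].
  by exists (j + c), 2; split; [left | apply/HV_pal_row2].
by exists (j + c), 3; split; [right | apply/HV_pal_row3].
Qed.

Definition letter2 (a : S) : fin_word2 S :=
  existT (fun p : nat * nat => 'M[S]_(p.1, p.2)) (1, 1) (const_mx a).

Lemma letter2_inj : injective letter2.
Proof.
move=> a b /(congr1 (fun u => entry2 u 0 0)).
by rewrite /entry2 /= !insubT /= !mxE => -[].
Qed.

Lemma factor_at_letter w i j : factor_at w i j 1 1 = letter2 (w i j).
Proof.
rewrite /factor_at /letter2; congr existT; apply/matrixP => k l.
by rewrite !mxE !ord1 !addn0.
Qed.

Lemma HV_pal_letter w a : Alph w a -> HV_pal_factors w (letter2 a).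
Proof.
move=> [i [j <-]]; rewrite -factor_at_letter.
by apply/HV_pal_factors_at; split=> // -[|//] [|//].
Qed.

Lemma HV_pal_size1 w u : HV_pal_factors w u -> size2 u = (1, 1) ->
  exists2 a, Alph w a & u = letter2 a.
Proof.
move=> [[i [j [m [n ->]]]] _ _] [-> ->].
by exists (w i j); [exists i, j | exact: factor_at_letter].
Qed.

End Factors.

(** * Counting letters together with non-trivial factors *)

Section Count.
Variables (S : Type) (w : inf_word2 S) (q r : nat).
Variables (us : nat -> fin_word2 S).
Hypothesis Alph_card : Alph w #= `I_q.
Hypothesis us_HV : forall k, k < r -> HV_pal_factors w (us k).
Hypothesis us_nontrivial : forall k, k < r -> size2 (us k) <> (1, 1).
Hypothesis us_inj : forall k l, k < r -> l < r -> us k = us l -> k = l.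

(** [F] lists first the [q] letters, through an inverse of the bijection from the alphabet to [I_q],
    and then the [r] given factors. The two blocks are disjoint by size. Knowing the image exactly
    serves both the lower bound and the equality. *)
Lemma HV_pal_enum : exists2 F : nat -> fin_word2 S,
  {in `I_(q + r) &, injective F} &
  F @` `I_(q + r) =
    HV_pal_factors w `&` [set u | size2 u = (1, 1)] `|` us @` `I_r.
Proof.
have /card_set_bijP[phi [phiA phi_inj phi_surj]] := Alph_card.
have : forall k, exists a, k < q -> Alph w a /\ phi a = k.
  (* For [k >= q] the letter is irrelevant, and [w 0 0] is a default value. *)
  move=> k; have [kq|_] := ltnP k q; last by exists (w 0 0).
  by have [a Aa phia] := phi_surj k kq; exists a.
move=> /choice[g gP]; pose F k := if k < q then letter2 (g k) else us (k - q).
exists F.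
  move=> k l; rewrite !inE /F /= => kqr lqr.
  have [kq|qk] := ltnP k q; have [lq|ql] := ltnP l q.
  - by move=> E; rewrite -(gP k kq).2 -(gP l lq).2 (letter2_inj E).
  - by move=> E; have [] := us_nontrivial (k := l - q) (ltac:(lia)); rewrite -E.
  - by move=> E; have [] := us_nontrivial (k := k - q) (ltac:(lia)); rewrite E.
  - move=> E; have := us_inj (k := k - q) (l := l - q) _ _ E; lia.
apply/seteqP; split=> [_ [k /= kqr <-]|u [[uHV u1]|[k kr <-]]].
- rewrite /F; case: ltnP => [kq|qk].
    by left; split=> //; apply: HV_pal_letter; exact: (gP k kq).1.
  by right; exists (k - q) => //=; lia.
- have [a Aa ->] := HV_pal_size1 uHV u1.
  have phiq : phi a < q by apply: phiA.
  exists (phi a) => /=; first by lia.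
  rewrite /F phiq; congr letter2.
  by apply: phi_inj; rewrite ?inE ?(gP _ phiq).2 //; exact: (gP _ phiq).1.
- exists (q + k) => /=; first by rewrite ltn_add2l.
  by rewrite /F ltnNge leq_addr /= addKn.
Qed.

Lemma HV_pal_card_ge : `I_(q + r) #<= HV_pal_factors w.
Proof.
have [F Finj FE] := HV_pal_enum.
rewrite -(card_le_eql (inj_card_eq Finj)); apply: subset_card_le.
by rewrite FE => u [[]|[k kr <-]] //; exact: us_HV.
Qed.

Lemma HV_pal_card_eq :
  (forall u, HV_pal_factors w u -> size2 u <> (1, 1) ->
     exists2 k, k < r & u = us k) ->
  HV_pal_factors w #= `I_(q + r).
Proof.
move=> all_us; have [F Finj FE] := HV_pal_enum.
suff -> : HV_pal_factors w = F @` `I_(q + r) by exact: inj_card_eq.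
rewrite FE; apply/seteqP; split=> [u uHV|u [[]|[k kr <-]] //]; last exact: us_HV.
have [u1|u1] := pselect (size2 u = (1, 1)); first by left.
by have [k kr ->] := all_us u uHV u1; right; exists k.
Qed.

End Count.

(** * Three letters force a second non-trivial HV-palindrome *)

(* In both lemmas the letters are coded by numbers below 3, and the columns are
   those without palindromes. *)
Lemma three_letters_aa (v : nat -> nat -> nat) (i j : nat) :
  (forall i j, v i j < 3) ->
  (forall i j, v i j <> v i.+1 j) -> (forall i j, v i j <> v i.+2 j) ->
  (forall i j, v i j <> v i j.+2) ->
  v i j = v i j.+1 ->
  (forall i' j', v i' j' = v i' j'.+1 -> v i' j' = v i j) ->
  False.
Proof.
move=> v3 vcol2 vcol3 vrow3 aa uniq_aa.
(* Write a for [v i j]. If the entries of row [k] in columns [j] and [j.+1] both avoid a, they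
   differ, because only a may be doubled. The next entry differs from both, so it is a. *)
have third k : v k j <> v i j -> v k j.+1 <> v i j -> v k j.+2 = v i j.
  have := (v3 i j, v3 k j, v3 k j.+1, v3 k j.+2).
  have := (uniq_aa k j, uniq_aa k j.+1, vrow3 k j).
  by move=> [[U1 U2] R] [[[b0 b1] b2] b3] d0 d1; lia.
(* Below row [i], columns [j] and [j.+1] avoid a for two rows, so [third] puts a twice in succession
   in column [j.+2]. *)
apply: (vcol2 i.+1 j.+2).
have := (vcol2 i j, vcol3 i j, vcol2 i j.+1, vcol3 i j.+1).
by move=> [[[d2 d3] d2'] d3']; rewrite !third //; lia.
Qed.

Lemma three_letters_aba (v : nat -> nat -> nat) (i j : nat) :
  (forall i j, v i j < 3) ->
  (forall i j, v i j <> v i.+1 j) -> (forall i j, v i j <> v i.+2 j) ->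
  (forall i j, v i j <> v i j.+1) ->
  v i j = v i j.+2 ->
  (forall i' j', v i' j' = v i' j'.+2 -> v i' j' = v i j) ->
  False.
Proof.
move=> v3 vcol2 vcol3 vrow2 aba uniq_aba.
(* If the outer entries avoid the letter [v i j], they differ, because only that letter may surround
   another one. The middle entry differs from both neighbours, so it is [v i j]; this applies to
   rows [i.+1] and [i.+2]. *)
have middle k : v k j <> v i j -> v k j.+2 <> v i j -> v k j.+1 = v i j.
  have := (v3 i j, v3 k j, v3 k j.+1, v3 k j.+2).
  have := (uniq_aba k j, vrow2 k j, vrow2 k j.+1).
  by move=> [[U1 U2] R] [[[b0 b1] b2] b3] d0 d1; lia.
apply: (vcol2 i.+1 j.+1).
have := (vcol2 i j, vcol3 i j, vcol2 i j.+2, vcol3 i j.+2).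
by move=> [[[d2 d3] d2'] d3']; rewrite !middle //; lia.
Qed.

(** Uniqueness is assumed only for the size and the first letter. This is all the two preceding
    lemmas use, and it can be checked for the transposed word too. *)
Lemma row_palindrome_not_unique (S : Type) (w : inf_word2 S)
    (phi : S -> nat) (i j n : nat) :
  (forall k l, phi (w k l) < 3) ->
  (forall k l k' l', phi (w k l) = phi (w k' l') -> w k l = w k' l') ->
  n = 2 \/ n = 3 ->
  HV_pal_factors w (factor_at w i j 1 n) ->
  (forall k l m' n', HV_pal_factors w (factor_at w k l m' n') ->
     (m', n') <> (1, 1) -> [/\ m' = 1, n' = n & w k l = w i j]) ->
  False.
Proof.
move=> phi3 phi_inj n23 wP uniq_at; pose v k l := phi (w k l).
have vcol2 k l : v k l <> v k.+1 l.
  by move/phi_inj/HV_pal_col2/uniq_at => /(_ (ltac:(done)))[].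
have vcol3 k l : v k l <> v k.+2 l.
  by move/phi_inj/HV_pal_col3/uniq_at => /(_ (ltac:(done)))[].
case: n23 => En; subst n.
  apply: (@three_letters_aa v i j) => // [k l||k l].
  - by move/phi_inj/HV_pal_row3/uniq_at => /(_ (ltac:(done)))[].
  - by move/HV_pal_row2: wP; rewrite /v => ->.
  - move/phi_inj/HV_pal_row2/uniq_at => /(_ (ltac:(done)))[_ _].
    by rewrite /v => ->.
apply: (@three_letters_aba v i j) => // [k l||k l].
- by move/phi_inj/HV_pal_row2/uniq_at => /(_ (ltac:(done)))[].
- by move/HV_pal_row3: wP; rewrite /v => ->.
- move/phi_inj/HV_pal_row3/uniq_at => /(_ (ltac:(done)))[_ _].
  by rewrite /v => ->.
Qed.

Lemma two_nontrivial_HV_pal (S : Type) (w : inf_word2 S) :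
  Alph w #= `I_3 -> has_nontrivial_HV_pal w ->
  exists u v, [/\ HV_pal_factors w u, HV_pal_factors w v,
    size2 u <> (1, 1), size2 v <> (1, 1) & u <> v].
Proof.
move=> /card_set_bijP[phi [phiA phi_inj _]] [u uP u1].
have inA k l : Alph w (w k l) by exists k, l.
have phi3 k l : phi (w k l) < 3 by exact: phiA.
have {}phi_inj k l k' l' : phi (w k l) = phi (w k' l') -> w k l = w k' l'.
  by apply: phi_inj; rewrite inE.
apply: contrapT => no2.
have uniqP x y : HV_pal_factors w x -> size2 x <> (1, 1) ->
    HV_pal_factors w y -> size2 y <> (1, 1) -> x = y.
  by move=> xP x1 yP y1; apply: contrapT => xy; apply: no2; exists x, y.
have [[i [j [m [n uE]]]] [m0 n0] _] := uP; subst u.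
rewrite /= in m0 n0 u1.
have [n1|n1] := ltnP 1 n.
  (* The short palindrome obtained here is non-trivial, so by [uniqP] it can replace the given
     factor as the unique one. *)
  have [j' [n' [n'23 P]]] := HV_pal_row_short uP n1.
  have P1 : (1, n') <> (1, 1) by move=> [? ]; lia.
  apply: (row_palindrome_not_unique phi3 phi_inj n'23 P) => k l m2 n2 kl ne1.
  have /factor_at_inj[Em En E] := uniqP _ _ kl ne1 P P1; split=> //.
  by have := E 0 0; rewrite !addn0; apply; lia.
have m1 : 1 < m by have : m <> 1 by [move=> m1; apply: u1; congr pair; lia]; lia.
(* A factor with a single column is treated as a row of the transposed word. *)
have [i' [m' [m'23 P]]] := HV_pal_row_short ((HV_pal_tr _ _ _ _ _).2 uP) m1.
have P1 : (m', 1) <> (1, 1) by move=> [? ]; lia.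
apply: (row_palindrome_not_unique _ _ m'23 P) => [k l|k l k' l'|k l m2 n2 kl ne1].
- exact: phi3.
- exact: phi_inj.
have ne1' : (n2, m2) <> (1, 1) by move=> [? ?]; apply: ne1; congr pair.
have /factor_at_inj[Em En E] :=
  uniqP _ _ ((HV_pal_tr _ _ _ _ _).1 kl) ne1' ((HV_pal_tr _ _ _ _ _).1 P) P1.
split=> //.
by have := E 0 0; rewrite !addn0; apply; lia.
Qed.

Lemma card_HV_pal_ge (S : Type) (w : inf_word2 S) (q : nat) :
  Alph w #= `I_q -> has_nontrivial_HV_pal w ->
  `I_(q + 1) #<= HV_pal_factors w.
Proof.
move=> Aq [u uP u1].
by apply: (@HV_pal_card_ge _ w q 1 (fun=> u)) => //; lia.
Qed.

Lemma card_HV_pal3_ge (S : Type) (w : inf_word2 S) :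
  Alph w #= `I_3 -> has_nontrivial_HV_pal w -> `I_5 #<= HV_pal_factors w.
Proof.
move=> A3 /(two_nontrivial_HV_pal A3)[u [v [uP vP u1 v1 uv]]].
apply: (@HV_pal_card_ge _ w 3 2 (fun k => if k == 0 then u else v)) => //.
- by move=> [].
- by move=> [].
- by move=> [|[|k]] [|[|l]] //= _ _ /esym.
Qed.

(** * The extremal words *)

(* Indices start from 0, so that the first column reads 2, 1, 3, 4, ..., q - 1,
   and then continues with i mod 3. *)
Definition extremal_code (q i j : nat) : nat :=
  if (j == 0) && (i == 0) then 2
  else if (j == 0) && (1 < i < q.-1) then i.+1 else (i + j.*2) %% 3.

Section Extremal.
Variable q : nat.
Hypothesis q3 : 2 < q.
Local Notation c := (extremal_code q).

Lemma extremal_code_lt i j : c i j < q.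
Proof. by rewrite /extremal_code; repeat case: ifP => ?; lia. Qed.

Lemma extremal_row2 i j : c i j = c i j.+1 <-> (i = 0 /\ j = 0).
Proof. by rewrite /extremal_code /=; repeat case: ifP => ?; lia. Qed.

Lemma extremal_row3 i j : c i j <> c i j.+2.
Proof. by rewrite /extremal_code /=; repeat case: ifP => ?; lia. Qed.

Lemma extremal_col2 i j : c i j <> c i.+1 j.
Proof. by rewrite /extremal_code /=; repeat case: ifP => ?; lia. Qed.

(** Away from the first column, a step of two rows changes the residue mod 3. In the first column
    the corner 2 meets 2 again two rows below when [q = 3], but meets the extra letter 3 when
    [q > 3]. *)
Lemma extremal_col3 i j : c i j = c i.+2 j <-> [/\ q = 3, i = 0 & j = 0].
Proof.
rewrite /extremal_code; repeat case: ifP => ?; split;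
  by [move=> ?; exfalso; lia | move=> ?; split; lia | move=> [? ? ?]; lia].
Qed.

Lemma extremal_code_onto k : k < q -> exists i j, c i j = k.
Proof.
case: k => [|[|[|k]]] kq.
- by exists 0, 3.
- by exists 0, 2.
- by exists 0, 0.
- by exists k.+2, 0; rewrite /extremal_code /=; case: ifP; lia.
Qed.

End Extremal.

(** Writing the number of letters as [n.+3] makes the type of letters inhabited, as [inord]
    requires. *)
Definition extremal_word (n : nat) : inf_word2 'I_n.+3 :=
  fun i j => inord (extremal_code n.+3 i j).

Lemma extremal_word_eq n i j i' j' :
  extremal_word n i j = extremal_word n i' j' <->
  extremal_code n.+3 i j = extremal_code n.+3 i' j'.
Proof.
split=> [/(congr1 val)|E]; last by rewrite /extremal_word E.
by rewrite /= !inordK ?extremal_code_lt.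
Qed.

Lemma Alph_extremal_word n : Alph (extremal_word n) #= `I_n.+3.
Proof.
suff -> : Alph (extremal_word n) = (@inord n.+2) @` `I_n.+3.
  apply: inj_card_eq => k l; rewrite !inE /= => kn ln.
  by move/(congr1 val); rewrite /= !inordK.
apply/seteqP; split=> [_ [i [j <-]]|_ [k /= kn <-]].
  by exists (extremal_code n.+3 i j) => //=; exact: extremal_code_lt.
by have [//|i [j E]] := @extremal_code_onto n.+3 _ k kn; exists i, j;
  rewrite /extremal_word E.
Qed.

Lemma extremal_HV_pal_row n :
  HV_pal_factors (extremal_word n) (factor_at (extremal_word n) 0 0 1 2).
Proof. by apply/HV_pal_row2/extremal_word_eq/extremal_row2. Qed.

Lemma extremal_HV_pal_col :
  HV_pal_factors (extremal_word 0) (factor_at (extremal_word 0) 0 0 3 1).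
Proof. by apply/HV_pal_col3/extremal_word_eq/extremal_col3. Qed.

(** Each row or column of length at least 2 has a center, and the code lemmas allow centers only at
    the corner. This fixes both the position and the size of the factor. *)
Lemma extremal_nontrivial n u :
  HV_pal_factors (extremal_word n) u -> size2 u <> (1, 1) ->
  u = factor_at (extremal_word n) 0 0 1 2 \/
  n = 0 /\ u = factor_at (extremal_word n) 0 0 3 1.
Proof.
move=> uP u1; have [[i [j [r [s uE]]]] [r0 s0] _] := uP; subst u.
rewrite /= in r0 s0 u1; have n3 : 2 < n.+3 by [].
have [s1|s1] := ltnP 1 s.
  have row k : k < r -> [/\ s = 2, i + k = 0 & j = 0].
    move=> kr; have [c [[sE /extremal_word_eq E]|[_ /extremal_word_eq E]]] :=
      HV_pal_row_center uP s1 kr.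
      by have [] := (extremal_row2 n3 _ _).1 E; split; lia.
    by case: (extremal_row3 n3 E).
  have [sE i0 j0] := row 0 r0.
  (* Every row of the factor has its center in row 0 of the word, so there is no second row. *)
  have r1 : r = 1.
    have [r1|] := ltnP 1 r; last by lia.
    by have [] := row 1 r1; lia.
  by left; rewrite (_ : i = 0) ?r1 ?sE ?j0 //; lia.
have r1 : 1 < r.
  by have : r <> 1 by [move=> r1; apply: u1; congr pair; lia]; lia.
have [c [[_ /extremal_word_eq E]|[rE /extremal_word_eq E]]] :=
    HV_pal_col_center uP r1 s0.
  by case: (extremal_col2 n3 E).
have [n0 i0 j0] := (extremal_col3 n3 _ _).1 E.
right; split; first by lia.
by congr (factor_at _ _ _ _ _); lia.
Qed.

Lemma extremal_admissible n : admissible n.+3 (extremal_word n).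
Proof.
split; first exact: Alph_extremal_word.
by exists (factor_at (extremal_word n) 0 0 1 2); first exact: extremal_HV_pal_row.
Qed.

Theorem theorem5p13 :
  is_L' 3 5 /\ (forall q : nat, 3 < q -> is_L' q (q + 1)).
Proof.
split=> [|q q3]; split.
- exists 'I_3, (extremal_word 0); split; first exact: extremal_admissible.
  pose us k := if k == 0 then factor_at (extremal_word 0) 0 0 1 2
               else factor_at (extremal_word 0) 0 0 3 1.
  apply: (@HV_pal_card_eq _ _ 3 2 us).
  + exact: Alph_extremal_word.
  + by move=> [|k] _; [exact: extremal_HV_pal_row|exact: extremal_HV_pal_col].
  + by move=> [|k] _.
  + by move=> [|[|k]] [|[|l]] // _ _ /factor_at_inj[].
  + move=> u uP /(extremal_nontrivial uP)[->|[_ ->]]; first by exists 0.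
    by exists 1.
- by move=> S w [A3 nt]; exact: card_HV_pal3_ge.
(* Here [n <> 0] excludes the column factor in [extremal_nontrivial], leaving a single non-trivial
   one. *)
- have [n -> n0] : exists2 n, q = n.+3 & n <> 0 by exists (q - 3); lia.
  exists 'I_n.+3, (extremal_word n); split; first exact: extremal_admissible.
  apply: (@HV_pal_card_eq _ _ n.+3 1
    (fun=> factor_at (extremal_word n) 0 0 1 2)) => //.
  + exact: Alph_extremal_word.
  + by move=> k _; exact: extremal_HV_pal_row.
  + by move=> k l; lia.
  + by move=> u uP /(extremal_nontrivial uP)[->|[]//]; exists 0.
- by move=> S w [Aq nt]; exact: card_HV_pal_ge.
Qed.
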